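(* Define the exponential generating functions (formal power series in $z$) $$\widetilde A(t,z):=z+\sum_{n\ge2}\widetilde A_{n-1}(t)\frac{z^n}{n!},\qquad \widetilde C(t,z):=1+\sum_{n\ge1}\widetilde C_n(t)\frac{z^n}{n!},$$ $$\widetilde B(t,z):=2+2tz+\sum_{n\ge2}\widetilde B_n(t)\frac{z^n}{n!},\qquad \widetilde D(t,z):=2+4t\frac{z^2}{2}+\sum_{n\ge3}\widetilde D_n(t)\frac{z^n}{n!}.$$ Then $$\widetilde A(t,z)=\frac{z(1-t)}{1-te^{z(1-t)}},\qquad \widetilde C(t,z)=\frac{1-t}{1-te^{2z(1-t)}},$$ $$\widetilde B(t,z)=\frac{2(1-t)\bigl(1-tze^{z(1-t)}\bigr)}{1-te^{2z(1-t)}},\qquad \widetilde D(t,z)=\frac{2(1-t)\bigl(1+tz^2-2tze^{z(1-t)}\bigr)}{1-te^{2z(1-t)}}.$$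
   Context: The affine Eulerian polynomials are the following generating functions for numbers of affine descents. Type $A$: for $n\ge2$, $\widetilde A_{n-1}(t)=\sum_{w\in S_n}t^{\widetilde d_A(w)}$, where $S_n$ is the symmetric group, $w=w_1\cdots w_n$, and $\widetilde d_A(w)=|\{i\in\{0,\dots,n-1\}:w_i>w_{i+1}\}|$ with $w_0=w_n$. Signed permutations: $B_n=C_n$ is the group of permutations $w$ of $\{\pm1,\dots,\pm n\}$ with $w(-i)=-w(i)$, written $w=w_1\cdots w_n$ with $w_i=w(i)$; $D_n$ is the subgroup of those $w$ with an even number of negative entries among $w_1,\dots,w_n$. Type $C$ ($n\ge1$): $\widetilde C_n(t)=\sum_{w\in C_n}t^{\widetilde d_C(w)}$, where $\widetilde d_C(w)=|\{i\in\{1,\dots,n\}:w_{i-1}>w_i\}|$ (with $w_0=0$), plus $1$ if $w_n>0$. Type $B$ ($n\ge2$): $\widetilde B_n(t)=\sum_{w\in B_n}t^{\widetilde d_B(w)}$, where $\widetilde d_B(w)=|\{i\in\{1,\dots,n\}:w_{i-1}>w_i\}|$ (with $w_0=0$), plus $1$ if $w_{n-1}+w_n>0$. Type $D$ ($n\ge3$): $\widetilde D_n(t)=\sum_{w\in D_n}t^{\widetilde d_D(w)}$, where $\widetilde d_D(w)=|\{i\in\{2,\dots,n\}:w_{i-1}>w_i\}|$, plus $1$ if $w_1+w_2<0$, plus $1$ if $w_{n-1}+w_n>0$. *)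

(* Defs.v *)
From HB Require Import structures.
From mathcomp Require Import all_boot all_order all_fingroup all_algebra.
From mathcomp Require Import boolp.

Set Implicit Arguments.
Unset Strict Implicit.
Unset Printing Implicit Defensive.

Import Order.TTheory GRing.Theory Num.Theory.
Local Open Scope ring_scope.

(* Formal power series in one variable z. Equality and choice on series come  *)
(* from classical logic, so that series form a comUnitRingType and x / y is   *)
(* the usual division as soon as the constant coefficient of y is a unit.     *)

Record fps (R : Type) := Fps { fcoef : nat -> R }.

HB.instance Definition _ (R : Type) := gen_eqMixin (fps R).
HB.instance Definition _ (R : Type) := gen_choiceMixin (fps R).

Lemma fpsP (R : Type) (f g : fps R) : fcoef f =1 fcoef g <-> f = g.
Proof.
split=> [|-> //]; case: f g => [f] [g] /= fg.
by congr Fps; apply/funext.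
Qed.

Section FpsZmodule.
Variable R : zmodType.
Implicit Types f g h : fps R.

Definition fps_zero : fps R := Fps (fun=> 0).
Definition fps_opp f := Fps (fun n => - fcoef f n).
Definition fps_add f g := Fps (fun n => fcoef f n + fcoef g n).

Fact fps_addA : associative fps_add.
Proof. by move=> f g h; apply/fpsP=> n; rewrite /= addrA. Qed.
Fact fps_addC : commutative fps_add.
Proof. by move=> f g; apply/fpsP=> n; rewrite /= addrC. Qed.
Fact fps_add0 : left_id fps_zero fps_add.
Proof. by move=> f; apply/fpsP=> n; rewrite /= add0r. Qed.
Fact fps_addN : left_inverse fps_zero fps_opp fps_add.
Proof. by move=> f; apply/fpsP=> n; rewrite /= addNr. Qed.

HB.instance Definition _ :=
  GRing.isZmodule.Build (fps R) fps_addA fps_addC fps_add0 fps_addN.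
End FpsZmodule.

Section FpsRing.
Variable R : comNzRingType.
Implicit Types f g h : fps R.

Definition fpsC (c : R) : fps R := Fps (fun n => c *+ (n == 0)%N).
Definition fpsX : fps R := Fps (fun n => (n == 1)%:R).

Definition fps_one : fps R := fpsC 1.
Definition fps_mul f g :=
  Fps (fun n => \sum_(i < n.+1) fcoef f i * fcoef g (n - i)).

Definition fps_trunc m f : {poly R} := \poly_(i < m) fcoef f i.

Fact coef_fps_mul m n f g : (n < m)%N ->
  fcoef (fps_mul f g) n = (fps_trunc m f * fps_trunc m g)`_n.
Proof.
move=> ltnm; rewrite coefM /=; apply: eq_bigr => i _; rewrite !coef_poly.
have -> : (i < m)%N by exact: leq_trans (ltn_ord i) ltnm.
by have -> : (n - i < m)%N by exact: leq_ltn_trans (leq_subr _ _) ltnm.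
Qed.

Fact fps_mulC : commutative fps_mul.
Proof.
by move=> f g; apply/fpsP=> n; rewrite !(@coef_fps_mul n.+1) // mulrC.
Qed.

Fact fps_mulA : associative fps_mul.
Proof.
move=> f g h; apply/fpsP=> n.
transitivity ((fps_trunc n.+1 f * (fps_trunc n.+1 g * fps_trunc n.+1 h))`_n).
  rewrite coefM; apply: eq_bigr => i _; rewrite coef_poly ltn_ord.
  by rewrite -coef_fps_mul // ltnS leq_subr.
rewrite mulrA coefM; apply: eq_bigr => i _.
by rewrite coef_poly ltnS leq_subr -coef_fps_mul.
Qed.

Fact fps_mul1 : left_id fps_one fps_mul.
Proof.
move=> f; apply/fpsP=> n /=; rewrite big_ord_recl /= subn0 mul1r big1 ?addr0//.
by move=> i _; rewrite mul0r.
Qed.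

Fact fps_mulDl : left_distributive fps_mul (@fps_add R).
Proof.
move=> f g h; apply/fpsP=> n /=; rewrite -big_split /=.
by apply: eq_bigr => i _; rewrite mulrDl.
Qed.

Fact fps_one_neq0 : fps_one != 0.
Proof. by apply/eqP=> /fpsP/(_ 0%N)/eqP; rewrite /= oner_eq0. Qed.

HB.instance Definition _ := GRing.Zmodule_isComNzRing.Build (fps R)
  fps_mulA fps_mulC fps_mul1 fps_mulDl fps_one_neq0.

Lemma fcoefD f g n : fcoef (f + g) n = fcoef f n + fcoef g n.
Proof. by []. Qed.
Lemma fcoefN f n : fcoef (- f) n = - fcoef f n.
Proof. by []. Qed.
Lemma fcoefM f g n :
  fcoef (f * g) n = \sum_(i < n.+1) fcoef f i * fcoef g (n - i).
Proof. by []. Qed.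
Lemma fcoefC c n : fcoef (fpsC c) n = c *+ (n == 0)%N.
Proof. by []. Qed.
Lemma fcoef1 n : fcoef (1 : fps R) n = (n == 0)%:R.
Proof. by []. Qed.
End FpsRing.

Section FpsUnit.
Variable R : comUnitRingType.
Implicit Types f g : fps R.

Definition fps_unit : {pred fps R} := fun f => fcoef f 0 \is a GRing.unit.

(* The coefficients of 1 / f in degrees < n, by the usual recursion. *)
Fixpoint fps_inv_seq f (n : nat) : seq R :=
  if n is m.+1 then
    let s := fps_inv_seq f m in
    rcons s ((fcoef f 0)^-1 *
             ((m == 0)%:R - \sum_(i < m) fcoef f (m - i) * s`_i))
  else [::].

Definition fps_inv f : fps R :=
  if f \in fps_unit then Fps (fun n => (fps_inv_seq f n.+1)`_n) else f.

Fact size_fps_inv_seq f n : size (fps_inv_seq f n) = n.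
Proof. by elim: n => //= n IHn; rewrite size_rcons IHn. Qed.

Fact nth_fps_inv_seq f m n : (m < n)%N ->
  (fps_inv_seq f n)`_m = (fps_inv_seq f m.+1)`_m.
Proof.
elim: n => // n IHn; rewrite ltnS leq_eqVlt => /predU1P[-> //|ltmn].
by rewrite [LHS]/= nth_rcons size_fps_inv_seq ltmn IHn.
Qed.

Fact fps_mulV : {in fps_unit, left_inverse 1 fps_inv *%R}.
Proof.
move=> f Uf; rewrite /fps_inv Uf mulrC; apply/fpsP=> n.
rewrite fcoefM big_ord_recl subn0.
have -> : fcoef (Fps (fun n => (fps_inv_seq f n.+1)`_n)) n =
    (fcoef f 0)^-1 * ((n == 0)%:R -
      \sum_(i < n) fcoef f (n - i) * (fps_inv_seq f i.+1)`_i).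
  rewrite /= nth_rcons size_fps_inv_seq ltnn eqxx; congr (_ * (_ - _)).
  by apply: eq_bigr => i _; rewrite nth_fps_inv_seq.
rewrite mulrA divrr ?mul1r; last exact: Uf.
rewrite [X in _ + X](_ : _ =
    \sum_(i < n) fcoef f (n - i) * (fps_inv_seq f i.+1)`_i) ?subrK//.
rewrite (reindex_inj rev_ord_inj) /=; apply: eq_bigr => i _.
by rewrite /bump leq0n add1n subnSK // subKn // ltnW.
Qed.

Fact fps_unitPl f g : g * f = 1 -> fps_unit f.
Proof.
move=> /fpsP/(_ 0%N); rewrite fcoefM big_ord1 /= => gf1.
by apply/unitrPr; exists (fcoef g 0); rewrite mulrC.
Qed.

Fact fps_inv_out : {in [predC fps_unit], fps_inv =1 id}.
Proof. by move=> f /negbTE Uf; rewrite /fps_inv Uf. Qed.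

HB.instance Definition _ :=
  GRing.ComNzRing_hasMulInverse.Build (fps R) fps_mulV fps_unitPl fps_inv_out.

Lemma fps_unitE f : (f \is a GRing.unit) = (fcoef f 0 \is a GRing.unit).
Proof. by []. Qed.

(* exp f = \sum_k f^k / k!, for f with zero constant coefficient: f ^+ k then *)
(* contributes to the coefficient of degree n only when k <= n.               *)
Definition fps_exp f : fps R :=
  Fps (fun n => \sum_(k < n.+1) fcoef (f ^+ k) n / k`!%:R).

Lemma fps_exp0 f : fcoef (fps_exp f) 0 = 1.
Proof. by rewrite /= big_ord1 /= invr1 mulr1. Qed.
End FpsUnit.

(* The field of rational functions in t, and power series in z over it. *)
Definition Qt := {fraction {poly rat}}.
Definition t : fps Qt := fpsC (tofrac 'X).
Definition z : fps Qt := fpsX Qt.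

Lemma den_unit (f : fps Qt) : 1 - t * fps_exp f \is a GRing.unit.
Proof.
rewrite fps_unitE fcoefD fcoefN fcoefM big_ord1 fps_exp0 /= mulr1 unitfE.
rewrite subr_eq0 -tofrac1 tofrac_eq eq_sym; apply/eqP.
by move=> /(congr1 (fun p : {poly rat} => p.[0])); rewrite hornerX hornerC.
Qed.

(* \sum_(n >= m) (P n) z^n / n! *)
Definition egf_from (m : nat) (P : nat -> {poly rat}) : fps Qt :=
  Fps (fun n => if (m <= n)%N then tofrac (P n) / n`!%:R else 0).

(* letterA w i is the letter w_i of w_1 ... w_n, where moreover w_0 = w_n. *)
Definition wordA n (w : 'S_n) : seq nat := [seq (w j).+1 | j : 'I_n].
Definition letterA n (w : 'S_n) (i : nat) : nat :=
  nth 0%N (last 0%N (wordA w) :: wordA w) i.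

Lemma letterA0 n (w : 'S_n.+1) : letterA w 0 = (w ord_max).+1.
Proof.
rewrite /letterA /= (last_nth 0%N) /wordA size_map size_enum_ord /=.
rewrite (nth_map ord0) ?size_enum_ord //.
by rewrite -[n in nth _ _ n]/(val (@ord_max n)) nth_ord_enum.
Qed.

Lemma letterAE n (w : 'S_n) (j : 'I_n) : letterA w j.+1 = (w j).+1.
Proof.
by rewrite /letterA /= (nth_map j) ?size_enum_ord // nth_ord_enum.
Qed.

Definition affdesA n (w : 'S_n) : nat :=
  #|[set i : 'I_n | (letterA w i > letterA w i.+1)%N]|.

(* Indexed by the rank: affine_A m is a sum over 'S_m.+1. *)
Definition affine_A (m : nat) : {poly rat} :=
  \sum_(w : 'S_m.+1) 'X^(affdesA w).

(* The set {+-1, ..., +-n}: (s, i) stands for i + 1 if s = false, and for     *)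
(* - (i + 1) if s = true.                                                     *)
Definition pm (n : nat) : finType := (bool * 'I_n)%type.
Definition pm_val n (x : pm n) : int := (-1) ^+ x.1 * (x.2.+1)%:Z.
Definition pm_opp n (x : pm n) : pm n := (~~ x.1, x.2).

Definition signed_perms n : {set {perm pm n}} :=
  [set w : {perm pm n} | [forall x, w (pm_opp x) == pm_opp (w x)]].

(* letter w i is w_i = w(i) for 1 <= i <= n, and w_0 = 0. *)
Definition word n (w : {perm pm n}) : seq int :=
  [seq pm_val (w (false, j)) | j : 'I_n].
Definition letter n (w : {perm pm n}) (i : nat) : int := nth 0 (0 :: word w) i.

Lemma letterE n (w : {perm pm n}) (j : 'I_n) :
  letter w j.+1 = pm_val (w (false, j)).
Proof.
by rewrite /letter /= (nth_map j) ?size_enum_ord // nth_ord_enum.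
Qed.

Definition even_signed_perms n : {set {perm pm n}} :=
  [set w in signed_perms n | ~~ odd (count (fun a => a < 0) (word w))].

Definition affdesC n (w : {perm pm n}) : nat :=
  (\sum_(1 <= i < n.+1 | (letter w i.-1 > letter w i)%R) 1 + (letter w n > 0)%R)%N.

Definition affdesB n (w : {perm pm n}) : nat :=
  (\sum_(1 <= i < n.+1 | (letter w i.-1 > letter w i)%R) 1
   + (letter w n.-1 + letter w n > 0)%R)%N.

Definition affdesD n (w : {perm pm n}) : nat :=
  (\sum_(2 <= i < n.+1 | (letter w i.-1 > letter w i)%R) 1
   + (letter w 1 + letter w 2 < 0)%R + (letter w n.-1 + letter w n > 0)%R)%N.

Definition affine_C n : {poly rat} :=
  \sum_(w in signed_perms n) 'X^(affdesC w).
Definition affine_B n : {poly rat} :=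
  \sum_(w in signed_perms n) 'X^(affdesB w).
Definition affine_D n : {poly rat} :=
  \sum_(w in even_signed_perms n) 'X^(affdesD w).

Definition gfA : fps Qt := z + egf_from 2 (fun n => affine_A n.-1).
Definition gfC : fps Qt := 1 + egf_from 1 affine_C.
Definition gfB : fps Qt := 2 + 2 * t * z + egf_from 2 affine_B.
Definition gfD : fps Qt := 2 + 4 * t * (z ^+ 2 / 2) + egf_from 3 affine_D.

(* Main.v *)
(* Every affine Eulerian polynomial becomes a sum over words: sequences of    *)
(* (signed) letters with absolute values 1, ..., n. Such words are obtained   *)
(* by inserting the letters +-n into words of length n - 1. A letter extreme  *)
(* in absolute value, inserted between x and y, adds a descent exactly when   *)
(* x < y. So, if P_n is the generating polynomial of the descents of          *)
(* w_1 ... w_n, possibly completed with a zero at one or both ends,           *)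
(*   P_(n+1) = m t (1 - t) P_n' + (al + m n t) P_n,                           *)
(* where m is the number of signs and al depends only on the ends. Multiplying*)
(* the exponential generating function by 1 - t exp(m (1 - t) z) preserves    *)
(* this recurrence, and it is readily solved after that multiplication. This  *)
(* gives type C and, by insertion as well, ~A_n = (n + 1) P_n for unsigned    *)
(* words between two zeros. In types B and D, changing the sign of the last   *)
(* letter pairs up the words in such a way that, on average, the end          *)
(* contribution of type B is twice that of type C, minus t. With B_n the      *)
(* descent polynomial of the finite group of signed permutations, this gives  *)
(*   ~B_n = 2 ~C_n - 2 n t B_(n-1).                                           *)
(* In type D the same is done at both ends, after replacing D_n by the group  *)
(* of all signed permutations (changing the sign of the letter +-1 affects no *)
(* comparison), and then                                                      *)
(*   ~D_n = 2 ~C_n - 4 n t B_(n-1) + 2 n (n - 1) t ~C_(n-2).                  *)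
Require Import Defs.
From mathcomp Require Import all_boot all_order all_fingroup all_algebra.
From mathcomp Require Import zify ring.

Set Implicit Arguments.
Unset Strict Implicit.
Unset Printing Implicit Defensive.

Import Order.TTheory GRing.Theory Num.Theory.
Local Open Scope ring_scope.

(** * Words and insertion of an extreme letter *)

(** All the polynomials involved are sums of word weights over [swords] and satisfy P_(n+1) =
    [ins_op m al n] P_n ([sum_swordsS]). For the exponential generating function F this reads (1 - m
    t z) F_z = m t (1 - t) F_t + al F, and the derivation (1 - m t z) d/dz - m t (1 - t) d/dt
    annihilates t exp(m (1 - t) z). Hence F (1 - t exp(m (1 - t) z)) solves the same equation
    ([ins_op_exp_conv]), with initial value 1 - t. When words stand between two zeros, al = m t and
    the solution is the constant 1 - t ([cyclic_recurrence]); for signed words after a single zero,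
    al = 1 + t and it is (1 - t) exp((1 - t) z) ([half_recurrence]).

    This gives [egf_cycP] and [egf_halfP]. The former is type C and, after multiplication by z, type
    A ([sum_wtA]). Types B and D reduce to these two series by sign-reversing involutions at the
    ends of words ([sum_wtB], [sum_wtD]), where each deleted end letter accounts for a factor z. In
    type D, [two_affine_D] replaces the subgroup by the group of all signed permutations. *)

Definition ins (i : nat) (x : int) (w : seq int) : seq int :=
  take i w ++ x :: drop i w.

(* b tells whether both signs are allowed. *)
Definition sletters (b : bool) (n : nat) : seq int :=
  if b then [:: n%:Z; - n%:Z] else [:: n%:Z].

(** Generated by insertion, so that a sum over words of length n + 1 unfolds into a sum over
    insertions ([big_swords]); [is_sword] is the intrinsic description of the same words. *)
Fixpoint swords (b : bool) (n : nat) : seq (seq int) :=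
  if n is m.+1 then
    [seq ins ix.1 ix.2 w | w <- swords b m,
       ix <- [seq (i, x) | i <- iota 0 m.+1, x <- sletters b m.+1]]
  else [:: [::]].

Definition is_sword (b : bool) (n : nat) (s : seq int) : bool :=
  perm_eq (map absz s) (iota 1 n) && (b || all (fun x => 0 <= x) s).

Lemma size_is_sword b n s : is_sword b n s -> size s = n.
Proof. by case/andP=> /perm_size; rewrite size_map size_iota. Qed.

Lemma is_sword_uniq b n s : is_sword b n s -> uniq (map absz s).
Proof. by case/andP=> /perm_uniq-> _; exact: iota_uniq. Qed.

Lemma is_sword_bound b n s x : is_sword b n s -> x \in s -> (0 < absz x <= n)%N.
Proof.
case/andP=> /perm_mem sP _ /(map_f absz); rewrite sP mem_iota add1n ltnS.
by [].
Qed.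

Lemma sletters_abs b n x : x \in sletters b n -> absz x = n.
Proof. by case: b; rewrite /= !inE; [case/orP|]; move=> /eqP->; rewrite ?abszN. Qed.

Lemma mem_sletters b n x :
  absz x = n -> b || (0 <= x) -> x \in sletters b n.
Proof. by case: b => /=; rewrite !inE; lia. Qed.

Lemma perm_ins i x w : perm_eq (ins i x w) (x :: w).
Proof. by rewrite /ins perm_catC /= perm_cons perm_catC cat_take_drop. Qed.

Lemma iota1S n : iota 1 n.+1 = rcons (iota 1 n) n.+1.
Proof. by rewrite -{1}[n.+1]addn1 iotaD add1n cats1. Qed.

Lemma is_sword_ins b n i x w :
  is_sword b n w -> x \in sletters b n.+1 -> is_sword b n.+1 (ins i x w).
Proof.
move=> /andP[wP wb] xb; have xn := sletters_abs xb; apply/andP; split.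
  rewrite iota1S (permPl (perm_map absz (perm_ins i x w))) /= xn.
  by rewrite perm_sym perm_rcons perm_cons perm_sym.
case: b wb xb => //= wb; rewrite inE => /eqP->.
by rewrite (perm_all _ (perm_ins _ _ _)) /= wb.
Qed.

Lemma mem_swords b n s : (s \in swords b n) = is_sword b n s.
Proof.
elim: n s => [|n IHn] s.
  rewrite inE /is_sword; case: s => [|x s] /=; first by rewrite orbT.
  by apply/esym/negbTE/negP => /andP[/perm_size].
apply/allpairsP/idP => [[[w ix] [wP /allpairsP[[i x] [_ xP ixE]] ->]]|sP].
  rewrite [ix]ixE; rewrite IHn in wP.
  exact: is_sword_ins.
pose i := index n.+1 (map absz s).
have iP : (i < size s)%N.
  rewrite -(size_map absz) index_mem; case/andP: sP => /perm_mem -> _.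
  by rewrite mem_iota; lia.
have xn : absz (nth 0 s i) = n.+1.
  by rewrite -(nth_map 0 0%N) // nth_index // -index_mem size_map.
have sE : s = ins i (nth 0 s i) (take i s ++ drop i.+1 s).
  have szt : size (take i s) = i by rewrite size_takel // ltnW.
  rewrite /ins take_cat drop_cat szt ltnn subnn take0 drop0 cats0.
  by rewrite -drop_nth // cat_take_drop.
have szs := size_is_sword sP.
exists (take i s ++ drop i.+1 s, (i, nth 0 s i)); split=> //.
  rewrite IHn [(_, _).1]/=; case/andP: sP; rewrite {1 2}sE => sP sb.
  apply/andP; split.
    move: sP; rewrite iota1S (permPl (perm_map absz (perm_ins _ _ _))) /= xn.
    by rewrite perm_sym perm_rcons perm_cons perm_sym.
  move: sb; rewrite (perm_all _ (perm_ins _ _ _)) /=.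
  by case: (b) => //= /andP[].
apply/allpairsP; exists (i, nth 0 s i); split=> //; first by rewrite mem_iota -szs.
apply: mem_sletters => //; case/andP: sP => _.
by case: (b) => //= /allP; apply; apply: mem_nth.
Qed.

(** An insertion can be undone: the letter of absolute value n + 1 gives the position and the sign,
    and filtering it out gives back the shorter word. *)
Lemma swords_uniq b n : uniq (swords b n).
Proof.
elim: n => // n IHn; apply: allpairs_uniq => //.
  apply: allpairs_uniq => [||[i x] [j y] _ _ [-> ->] //].
    exact: iota_uniq.
  by case: b {IHn} => //=; rewrite !inE andbT; lia.
have key w i x : (w, (i, x)) \in [seq (w, ix) | w <- swords b n,
      ix <- [seq (i, x) | i <- iota 0 n.+1, x <- sletters b n.+1]] ->
    [/\ absz x = n.+1, i = index n.+1 (map absz (ins i x w)),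
      x = nth 0 (ins i x w) i
      & w = [seq y <- ins i x w | absz y != n.+1]].
  case/allpairsP=> -[w' [i' x']] [wP].
  case/allpairsP=> -[i'' x''] [+ /sletters_abs xn [-> ->] [-> -> ->]].
  rewrite mem_iota => leiw; rewrite /= in leiw wP xn *.
  move: wP; rewrite mem_swords => wP; have szw := size_is_sword wP.
  have szt : size (take i'' w') = i'' by rewrite size_takel // szw -ltnS.
  have wn y : y \in w' -> absz y != n.+1.
    move/(is_sword_bound wP)=> /andP[_]; rewrite -ltnS.
    by case: eqP => // ->; rewrite ltnn.
  split=> //.
  - rewrite map_cat index_cat /= xn eqxx addn0 size_map szt ifN //.
    by apply/mapP => -[y /mem_take/wn + yn]; rewrite -yn eqxx.
  - by rewrite nth_cat szt ltnn subnn.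
  - rewrite filter_cat /= xn eqxx /= -filter_cat cat_take_drop.
    by apply/esym/all_filterP/allP => y /wn.
case=> w [i x] [w' [i' x']] /key[xn iE xE wE] /key[x'n i'E x'E w'E] /= e.
rewrite e in iE xE wE; rewrite [w]wE -w'E.
have ei : i = i' by rewrite iE.
by rewrite ei [x]xE ei -x'E.
Qed.

Lemma big_swords b n (F : seq int -> {poly rat}) :
  \sum_(s <- swords b n.+1) F s =
  \sum_(w <- swords b n) \sum_(i < n.+1) \sum_(x <- sletters b n.+1)
     F (ins i x w).
Proof.
rewrite big_allpairs_dep; apply: eq_bigr => w _.
rewrite big_allpairs_dep; have -> : iota 0 n.+1 = index_iota 0 n.+1.
  by rewrite /index_iota subn0.
by rewrite big_mkord.
Qed.

Lemma perm_map_swords b n (f : seq int -> seq int) :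
  involutive f -> {in swords b n, forall s, f s \in swords b n} ->
  perm_eq (map f (swords b n)) (swords b n).
Proof.
move=> fK fP; have fU : uniq (map f (swords b n)).
  by rewrite map_inj_uniq ?swords_uniq //; apply: inv_inj.
have sub : {subset map f (swords b n) <= swords b n}.
  by move=> _ /mapP[s sP ->]; apply: fP.
apply: (uniq_perm fU (swords_uniq b n)).
by have [] := uniq_min_size fU sub (eq_leq (esym (size_map _ _))).
Qed.

Lemma sum_swords_inv b n (f : seq int -> seq int) (F : seq int -> {poly rat}) :
  involutive f -> {in swords b n, forall s, f s \in swords b n} ->
  \sum_(s <- swords b n) F (f s) = \sum_(s <- swords b n) F s.
Proof.
by move=> fK fP; rewrite -[RHS](perm_big _ (perm_map_swords fK fP)) big_map.
Qed.

(** * Descent weights and their recurrences *)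

(* A factor 'X for each descent; wt x s is the weight of the word x :: s. *)
Definition dw (x y : int) : {poly rat} := 'X^(nat_of_bool (y < x)%R).

Fixpoint wt (x : int) (s : seq int) : {poly rat} :=
  if s is y :: s' then dw x y * wt y s' else 1.

Definition wt0 (s : seq int) : {poly rat} := if s is x :: s' then wt x s' else 1.

Definition init (T : Type) (s : seq T) : seq T :=
  if s is x :: s' then belast x s' else [::].

Lemma init_rcons (T : Type) (s : seq T) x : init (rcons s x) = s.
Proof. by case: s => //= y s; rewrite belast_rcons. Qed.

Lemma ins_rcons i x w y :
  (i <= size w)%N -> ins i x (rcons w y) = rcons (ins i x w) y.
Proof.
move=> iw; rewrite /ins -!cats1 take_cat drop_cat.
case: ltngtP iw => // [iw _|-> _]; first by rewrite -catA.
by rewrite subnn take0 drop0 take_size drop_size cats0 -catA.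
Qed.

Lemma ins_size x w : ins (size w) x w = rcons w x.
Proof. by rewrite /ins take_size drop_size cats1. Qed.

Lemma wt_rcons x s y : wt x (rcons s y) = wt x s * dw (last x s) y.
Proof. by elim: s x => [|a s IHs] x /=; rewrite ?mul1r ?mulr1 // IHs mulrA. Qed.

Lemma dwE x y : dw x y = if y < x then 'X else 1.
Proof. by rewrite /dw; case: (y < x)%R. Qed.

(** This links descents to differentiation: it expresses a factor [dw x y] through its derivative,
    which is what the product rule needs in [wt_ins]. *)
Lemma deriv_dw x y : (1 - 'X) * (dw x y)^`() + dw x y = 1.
Proof. by rewrite dwE; case: ifP => _; rewrite ?derivX ?derivC; ring. Qed.

Lemma dw_absz_r x y N : (absz x < N)%N -> absz y = N ->
  dw x y = if 0 < y then 1 else 'X.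
Proof.
move=> xN yN; rewrite dwE; have -> : (y < x) = ~~ (0 < y) by lia.
by case: (0 < y).
Qed.

Lemma dw_absz_l x y N : (absz x < N)%N -> absz y = N ->
  dw y x = if 0 < y then 'X else 1.
Proof.
by move=> xN yN; rewrite dwE; have <- : (x < y) = (0 < y) by lia.
Qed.

(* An extreme letter inserted in the slot between x and y replaces the factor *)
(* dw x y by 'X, whatever its sign.                                           *)
Lemma wt_ins N X x s : absz X = N -> {in x :: s, forall y, (absz y < N)%N} ->
  \sum_(i < size s) wt x (ins i X s) =
  'X * (1 - 'X) * (wt x s)^`() + (size s)%:R * 'X * wt x s.
Proof.
move=> XN; elim: s x => [|y s IHs] x sN.
  by rewrite big_ord0 /= derivC; ring.
have xN : (absz x < N)%N by apply: sN; rewrite mem_head.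
have yN : (absz y < N)%N by apply: sN; rewrite !inE eqxx orbT.
rewrite big_ord_recl /= -mulr_sumr.
under eq_bigr => i _ do rewrite -/(ins i X s).
rewrite IHs; last by move=> a ha; apply: sN; rewrite inE ha orbT.
have -> : dw x X * (dw X y * wt y s) = 'X * wt y s.
  by rewrite (dw_absz_r xN XN) (dw_absz_l yN XN); case: ifP => _; ring.
rewrite derivM -natr1.
have dwD : dw x y = 1 - (1 - 'X) * (dw x y)^`().
  by rewrite -{1}(deriv_dw x y) addrAC subrr add0r.
by set d := (dw x y)^`(); rewrite dwD -/d; ring.
Qed.

(** With d descents among k slots, inserting an extreme letter in every slot gives d X^d + (k - d)
    X^(d+1) = X (1 - X) (X^d)' + k X X^d. Here m counts the signs and al corrects for the slots at
    the ends. *)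
Definition ins_op (m : nat) (al : {poly rat}) (k : nat) (f : {poly rat}) :=
  m%:R * 'X * (1 - 'X) * f^`() + (al + (m * k)%:R * 'X) * f.

(** Stated for a single word and any N above its absolute values, so that it also applies to what
    remains of a word after deletion of end letters, where the absolute values have gaps. *)
Definition has_ins_op (b : bool) (al : {poly rat}) (F : seq int -> {poly rat}) :=
  forall N w, (0 < N)%N -> {in w, forall y, (absz y < N)%N} ->
  \sum_(i < (size w).+1) \sum_(x <- sletters b N) F (ins i x w) =
  ins_op b.+1 al (size w) (F w).

Lemma big_sletters b N (G : int -> {poly rat}) :
  \sum_(x <- sletters b N) G x = G N%:Z + (if b then G (- N%:Z) else 0).
Proof. by case: b; rewrite /= !big_cons big_nil ?addr0. Qed.

Lemma ins_wtC b :
  has_ins_op b (b.+1%:R * 'X) (fun w => wt 0 (rcons w 0)).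
Proof.
move=> N w N0 wN; rewrite exchange_big /=.
have slot X : X \in sletters b N ->
    \sum_(i < (size w).+1) wt 0 (rcons (ins i X w) 0) =
    ins_op 1 'X (size w) (wt 0 (rcons w 0)).
  move=> /sletters_abs XN.
  have := @wt_ins N X 0 (rcons w 0) XN; rewrite size_rcons.
  under eq_bigr => i _ do rewrite (ins_rcons _ _ (leq_ord i)).
  move=> ->; last first.
    by move=> y; rewrite inE mem_rcons inE orbA orbb => /predU1P[->|/wN].
  by rewrite /ins_op mul1n -natr1; ring.
rewrite (eq_big_seq _ slot) big_sletters /ins_op natrM.
by case: b slot => _ /=; ring.
Qed.

(** The slot after the last letter is open: appending N creates no descent and appending -N creates
    one, whence 1 + X. *)
Lemma ins_wt_from0 : has_ins_op true (1 + 'X) (wt 0).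
Proof.
move=> N w N0 wN; rewrite exchange_big /=.
have w0N : {in 0 :: w, forall y, (absz y < N)%N}.
  by move=> y; rewrite inE => /predU1P[->|/wN].
have slot X : absz X = N ->
    \sum_(i < (size w).+1) wt 0 (ins i X w) =
    ins_op 1 (if 0 < X then 1 else 'X) (size w) (wt 0 w).
  move=> XN; rewrite big_ord_recr /= (wt_ins XN w0N) ins_size wt_rcons.
  rewrite (dw_absz_r _ XN); last by apply: w0N; rewrite mem_last.
  by rewrite /ins_op mul1n; case: ifP => _; ring.
rewrite big_cons big_seq1 !slot ?abszN // /ins_op natrM.
have -> : (0 < N%:Z) = true by lia.
have -> : (0 < - N%:Z) = false by lia.
by ring.
Qed.

(** For either sign, the two open ends of a nonempty word contribute 1 + X together. Only n - 1
    slots are interior, so the 2 + 2 X from both signs leaves al = 2. *)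
Lemma ins_wt0 : has_ins_op true 2 wt0.
Proof.
move=> N w N0 wN; rewrite exchange_big /=.
have N0' : (0 < N%:Z) = true by lia.
have N0'' : (0 < - N%:Z) = false by lia.
case: w wN => [|x s] wN.
  by rewrite big_cons big_seq1 !big_ord1 /ins_op /= muln0 derivC; ring.
have xN : (absz x < N)%N by apply: wN; rewrite mem_head.
have slot X : absz X = N ->
    \sum_(i < (size (x :: s)).+1) wt0 (ins i X (x :: s)) =
    ins_op 1 (if 0 < X then 1 + 'X else 1 + 'X) (size s) (wt0 (x :: s)).
  move=> XN; rewrite big_ord_recl big_ord_recr /=.
  under eq_bigr => i _ do rewrite -/(ins i X s).
  rewrite -/(ins (size s) X s) ins_size wt_rcons (wt_ins XN wN).
  rewrite (dw_absz_l xN XN) (dw_absz_r _ XN); last by apply: wN; rewrite mem_last.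
  by rewrite /ins_op mul1n; case: ifP => _; ring.
rewrite big_cons big_seq1 !slot ?abszN // N0' N0'' /ins_op !natrM /= -natr1.
by ring.
Qed.

Lemma ins_op_sum m al k I (r : seq I) (G : I -> {poly rat}) :
  ins_op m al k (\sum_(i <- r) G i) = \sum_(i <- r) ins_op m al k (G i).
Proof.
rewrite /ins_op raddf_sum !mulr_sumr -big_split /=.
by apply: eq_bigr.
Qed.

Lemma sum_swordsS b al F n : has_ins_op b al F ->
  \sum_(s <- swords b n.+1) F s = ins_op b.+1 al n (\sum_(s <- swords b n) F s).
Proof.
move=> Fst; rewrite big_swords ins_op_sum; apply: eq_big_seq => w.
rewrite mem_swords => wP; rewrite -(size_is_sword wP) Fst //.
by move=> y /(is_sword_bound wP) /andP[_]; rewrite (size_is_sword wP).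
Qed.

(** The factor counts the possible last letters. Instead of standardizing the remaining letters, the
    proof is by insertion: the extreme letter is either last, and its removal gives back w, or it is
    inserted into [init w]. *)
Lemma sum_swords_init al F n : has_ins_op true al F ->
  \sum_(s <- swords true n.+1) F (init s) =
  (2 * n.+1)%:R * \sum_(s <- swords true n) F s.
Proof.
move=> Fst; elim: n => [|n IHn].
  rewrite big_swords !big_seq1 big_ord1 big_cons big_seq1 /=.
  by rewrite !muln1; ring.
have step : {in swords true n.+1, forall w,
    \sum_(i < n.+2) \sum_(x <- sletters true n.+2) F (init (ins i x w)) =
    ins_op 2 al n (F (init w)) + 2 * F w}.
  move=> w; rewrite mem_swords => wP; have szw := size_is_sword wP.
  case/lastP: w wP szw => // v y wP; rewrite size_rcons => szw.
  have szv : n = size v by case: szw.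
  rewrite szv in wP *.
  have insl x : ins (size v).+1 x (rcons v y) = rcons (rcons v y) x.
    by rewrite -[RHS]ins_size size_rcons.
  rewrite big_ord_recr big_cons big_seq1 /= !insl !init_rcons.
  under eq_bigr => i _.
    under eq_bigr => x _ do rewrite (ins_rcons _ _ (leq_ord i)) init_rcons.
    over.
  rewrite (Fst (size v).+2 v) //; last first.
    move=> a av; have /(is_sword_bound wP) : a \in rcons v y.
      by rewrite mem_rcons inE av orbT.
    by case/andP.
  by ring.
rewrite big_swords (eq_big_seq _ step) big_split /= -mulr_sumr -ins_op_sum IHn.
rewrite (sum_swordsS _ Fst) /ins_op derivM.
rewrite -[(2 * n.+1)%:R]polyC_natr derivC polyC_natr !natrM -!natr1.
by ring.
Qed.

(** * Sign changes at the ends of a word *)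

(** Reversal together with negation preserves descents ([wt0_revN]) and exchanges the two ends of a
    word. *)
Definition revN (s : seq int) : seq int := rev (map -%R s).

Lemma revN_cons x s : revN (x :: s) = rcons (revN s) (- x).
Proof. by rewrite /revN /= rev_cons. Qed.

Lemma revN_rcons x s : revN (rcons s x) = - x :: revN s.
Proof. by rewrite /revN map_rcons rev_rcons. Qed.

Lemma revNK : involutive revN.
Proof.
move=> s; rewrite /revN map_rev revK -map_comp map_id_in // => x _ /=.
by rewrite opprK.
Qed.

Lemma behead_revN s : behead (revN s) = revN (init s).
Proof. by case/lastP: s => // s x; rewrite revN_rcons init_rcons. Qed.

Lemma init_revN s : init (revN s) = revN (behead s).
Proof. by case: s => // x s; rewrite revN_cons init_rcons. Qed.

Lemma dwN x y : dw (- y) (- x) = dw x y.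
Proof. by rewrite /dw ltrN2. Qed.

Lemma wt0_rcons2 s x y : wt0 (rcons (rcons s x) y) = wt0 (rcons s x) * dw x y.
Proof. by case: s => [|a s] /=; rewrite ?mul1r ?mulr1 // wt_rcons last_rcons. Qed.

Lemma wt0_revN s : wt0 (revN s) = wt0 s.
Proof.
elim: s => // x [|y s] //; rewrite !revN_cons wt0_rcons2 => ->.
by rewrite dwN mulrC.
Qed.

Lemma sword_perm_abs n s s' : perm_eq (map absz s') (map absz s) ->
  s \in swords true n -> s' \in swords true n.
Proof. by rewrite !mem_swords /is_sword !orTb !andbT => /permPl->. Qed.

Lemma revN_sword n : {in swords true n, forall s, revN s \in swords true n}.
Proof.
move=> s; apply: sword_perm_abs; rewrite /revN map_rev -map_comp.
rewrite perm_rev (eq_map (g := absz)) // => x /=; exact: abszN.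
Qed.

Definition flip_head (s : seq int) : seq int :=
  if s is x :: s' then - x :: s' else [::].

Definition flip_last (s : seq int) : seq int := rev (flip_head (rev s)).

Lemma flip_last_rcons s x : flip_last (rcons s x) = rcons s (- x).
Proof. by rewrite /flip_last rev_rcons /= rev_cons revK. Qed.

Lemma flip_headK : involutive flip_head.
Proof. by case=> //= x s; rewrite opprK. Qed.

Lemma flip_lastK : involutive flip_last.
Proof. by move=> s; rewrite /flip_last revK flip_headK revK. Qed.

Lemma map_abs_flip_head s : map absz (flip_head s) = map absz s.
Proof. by case: s => //= x s; rewrite abszN. Qed.

Lemma flip_head_sword n :
  {in swords true n, forall s, flip_head s \in swords true n}.
Proof. by move=> s; apply: sword_perm_abs; rewrite map_abs_flip_head. Qed.

Lemma flip_last_sword n :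
  {in swords true n, forall s, flip_last s \in swords true n}.
Proof.
move=> s; apply: sword_perm_abs.
by rewrite /flip_last map_rev map_abs_flip_head map_rev revK.
Qed.

Lemma sum_swords_anti b n (f : seq int -> seq int) (F : seq int -> {poly rat}) :
  involutive f -> {in swords b n, forall s, f s \in swords b n} ->
  {in swords b n, forall s, F s + F (f s) = 0} ->
  \sum_(s <- swords b n) F s = 0.
Proof.
move=> fK fP Ff; have : \sum_(s <- swords b n) (F s + F (f s)) = 0.
  by apply: big1_seq => s /andP[_]; apply: Ff.
rewrite big_split /= (sum_swords_inv _ fK fP) -mulr2n -mulr_natr => /eqP.
by rewrite mulf_eq0 -polyC_natr polyC_eq0 orbF => /eqP.
Qed.

(** * Deleting the first and the last letter *)

Definition mid (s : seq int) : seq int := behead (init s).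

Lemma mid_cons_rcons x u y : mid (x :: rcons u y) = u.
Proof. by rewrite /mid -rcons_cons init_rcons. Qed.

Lemma sum_wt0_behead n :
  \sum_(s <- swords true n.+1) wt0 (behead s) =
  (2 * n.+1)%:R * \sum_(s <- swords true n) wt0 s.
Proof.
rewrite -(sum_swords_init _ ins_wt0).
rewrite -(sum_swords_inv _ revNK (@revN_sword _)).
by apply: eq_bigr => s _; rewrite behead_revN wt0_revN.
Qed.

Lemma sword_cons_rconsP n s : s \in swords true n.+2 ->
  exists x u y, s = x :: rcons u y /\ size u = n.
Proof.
rewrite mem_swords => /size_is_sword; case: s => // x s.
case/lastP: s => // u y /=; rewrite size_rcons => -[szu].
by exists x, u, y.
Qed.

(** The factor counts the pairs of end letters: (n + 2)(n + 1) absolute values and four choices of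
    signs. The induction is that of [sum_swords_init]. *)
Lemma sum_wt0_mid n :
  \sum_(s <- swords true n.+2) wt0 (mid s) =
  (4 * (n.+2 * n.+1))%:R * \sum_(s <- swords true n) wt0 s.
Proof.
elim: n => [|n IHn].
  have e : {in swords true 2, forall s, wt0 (mid s) = 1}.
    by move=> s /sword_cons_rconsP[x [u [y [-> /size0nil ->]]]].
  by rewrite (eq_big_seq _ e) big_const_seq iter_addr /= big_seq1 /= addr0 mulr1.
(* The three terms correspond to the extreme letter being first, being last, or lying inside
   [mid]. *)
have step : {in swords true n.+2, forall w,
    \sum_(i < n.+3) \sum_(x <- sletters true n.+3) wt0 (mid (ins i x w)) =
    2 * wt0 (init w) + 2 * wt0 (behead w) + ins_op 2 2 n (wt0 (mid w))}.
  move=> w wP; have [a [u [c [wE szu]]]] := sword_cons_rconsP wP.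
  move: wP; rewrite {}wE -{}szu => {n IHn} wP.
  have insl x : ins (size u).+2 x (a :: rcons u c) = rcons (a :: rcons u c) x.
    by rewrite -[RHS]ins_size /= size_rcons.
  rewrite big_ord_recl big_ord_recr /=.
  rewrite !big_cons !big_nil /= !insl /mid !init_rcons /= belast_rcons.
  have midl (i : 'I_(size u).+1) x : behead (belast a
      (take (0 + i) (rcons u c) ++ x :: drop (0 + i) (rcons u c))) = ins i x u.
    rewrite add0n -/(ins i x (rcons u c)) (ins_rcons _ _ (leq_ord i)).
    by rewrite belast_rcons.
  under eq_bigr => i _ do under eq_bigr => x _ do rewrite midl.
  have := @ins_wt0 (size u).+3 u isT.
  move=> /= ->; first by ring.
  move=> y yu; move: wP; rewrite mem_swords => /is_sword_bound-/(_ y).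
  by rewrite inE mem_rcons inE yu !orbT => /(_ isT)/andP[].
rewrite big_swords (eq_big_seq _ step) 2!big_split /= -ins_op_sum -!mulr_sumr IHn.
rewrite sum_wt0_behead (sum_swords_init _ ins_wt0).
rewrite (sum_swordsS _ ins_wt0) /ins_op derivM.
rewrite -[(4 * _)%:R]polyC_natr derivC polyC_natr !natrM -!natr1.
by ring.
Qed.

(* LC and LB are the contributions of the end of the word (comparisons after  *)
(* the letter w_(n-1) = y) in types C and B; the front contributions are    *)
(* those of the reversed and negated word.                                   *)
Definition LC (y x : int) : {poly rat} := dw y x * dw x 0.
Definition LB (y x : int) : {poly rat} := dw y x * dw (y + x) 0.

(** If |x| > |y|, all four contributions equal X. If |x| < |y|, the sign of y decides: [LB] is X^2
    for both signs of x while [LC] takes the values X^2 and X, or [LB] is 1 while [LC] takes the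
    values X and 1. So 2 [LC] - [LB] averages to X. *)
Lemma LC_LB_flip y x : absz x != absz y -> x != 0 -> y != 0 ->
  (2 * LC y x - LB y x - 'X) + (2 * LC y (- x) - LB y (- x) - 'X) = 0.
Proof.
move=> xy x0 y0; rewrite /LC /LB !dwE.
case: (ltP x y) => h1; case: (ltP 0 x) => h2; case: (ltP 0 (y + x)) => h3;
case: (ltP (- x) y) => h4; case: (ltP 0 (- x)) => h5;
case: (ltP 0 (y - x)) => h6; solve [ring | exfalso; lia].
Qed.

Lemma LCN x y : LC (- y) (- x) = dw 0 x * dw x y.
Proof. by rewrite /LC dwN mulrC -(dwN 0 x) oppr0. Qed.

(** * Reduction of types B and D to type C *)

Definition wtC (s : seq int) := wt 0 (rcons s 0).
Definition wtB (s : seq int) := wt 0 (init s) * LB (last 0 (init s)) (last 0 s).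
Definition wtD (s : seq int) :=
  LB (- head 0 (mid s)) (- head 0 s) * wt0 (mid s) * LB (last 0 (mid s)) (last 0 s).

Lemma sword_rcons2P n s : s \in swords true n.+2 ->
  exists v y x, [/\ s = rcons (rcons v y) x, size v = n,
    absz x != absz y, x != 0 & y != 0].
Proof.
rewrite mem_swords => sP; have szs := size_is_sword sP.
case/lastP: s sP szs => // s x; case/lastP: s => [|v y] sP.
  by [].
rewrite !size_rcons => -[szv]; exists v, y, x; split=> //.
- have := is_sword_uniq sP; rewrite !map_rcons !rcons_uniq mem_rcons inE.
  by case/andP; rewrite negb_or => /andP[].
- by have /(is_sword_bound sP) : x \in rcons (rcons v y) x;
    [rewrite mem_rcons mem_head | lia].
- by have /(is_sword_bound sP) : y \in rcons (rcons v y) x;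
    [rewrite mem_rcons inE mem_rcons mem_head orbT | lia].
Qed.

(** Changing the sign of the last letter cancels the sum of 2 [wtC s] - [wtB s] - X [wt 0 (init s)],
    by [LC_LB_flip]; the last term is then summed by [sum_swords_init]. *)
Lemma sum_wtB n :
  \sum_(s <- swords true n.+2) wtB s =
  2 * (\sum_(s <- swords true n.+2) wtC s)
  - (2 * n.+2)%:R * 'X * \sum_(s <- swords true n.+1) wt 0 s.
Proof.
have alg (w a b c d e f x : {poly rat}) :
    (2 * (a * b) - c - x) + (2 * (d * e) - f - x) = 0 ->
    (2 * (w * a * b) - w * c - x * w) + (2 * (w * d * e) - w * f - x * w) = 0.
  by move=> h; rewrite -[RHS](mulr0 w) -h; ring.
have alg2 (c b k x r : {poly rat}) :
    c - b - x * (k * r) = 0 -> b = c - k * x * r.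
  by move=> h; rewrite -[LHS]addr0 -h; ring.
have anti : {in swords true n.+2, forall s,
    (2 * wtC s - wtB s - 'X * wt 0 (init s)) + (2 * wtC (flip_last s)
      - wtB (flip_last s) - 'X * wt 0 (init (flip_last s))) = 0}.
  move=> s /sword_rcons2P[v [y [x [-> _ xy x0 y0]]]].
  have := LC_LB_flip xy x0 y0; rewrite /LC => h.
  rewrite flip_last_rcons /wtC /wtB !init_rcons !last_rcons.
  rewrite ![wt 0 (rcons (rcons (rcons _ _) _) _)]wt_rcons.
  rewrite ![wt 0 (rcons (rcons _ _) _)]wt_rcons !last_rcons.
  exact: alg h.
have := sum_swords_anti flip_lastK (@flip_last_sword _) anti.
rewrite !sumrB -!mulr_sumr (sum_swords_init _ ins_wt_from0).
exact: alg2.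
Qed.

(** Under the sum, each end contribution [LB] may be replaced by 2 [LC] - X, one end after the
    other. Expanding (2 FC - X) M (2 EC - X) gives the three sums on the right. Length at least 3
    keeps [mid] nonempty, so that changing the sign at one end does not affect the other. *)
Lemma sum_wtD n :
  \sum_(s <- swords true n.+3) wtD s =
  4 * (\sum_(s <- swords true n.+3) wtC s)
  - 4 * (2 * n.+3)%:R * 'X * (\sum_(s <- swords true n.+2) wt 0 s)
  + (4 * (n.+3 * n.+2))%:R * 'X ^+ 2 * \sum_(s <- swords true n.+1) wt0 s.
Proof.
pose FB s := LB (- head 0 (mid s)) (- head 0 s).
pose FC s := LC (- head 0 (mid s)) (- head 0 s).
pose EB s := LB (last 0 (mid s)) (last 0 s).
pose EC s := LC (last 0 (mid s)) (last 0 s).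
pose M s := wt0 (mid s).
have antiE : {in swords true n.+3, forall s,
    FB s * M s * (2 * EC s - EB s - 'X) + FB (flip_last s) * M (flip_last s)
     * (2 * EC (flip_last s) - EB (flip_last s) - 'X) = 0}.
  move=> s sP; have [v [y [x [sE szv xy x0 y0]]]] := sword_rcons2P sP.
  have h := LC_LB_flip xy x0 y0.
  case: v sE szv => // a v -> _.
  rewrite flip_last_rcons /FB /M /EC /EB /=.
  rewrite !mid_cons_rcons !last_rcons -mulrDr h mulr0.
  by [].
have alg (p q m e : {poly rat}) : p + q = 0 -> p * m * e + q * m * e = 0.
  by move=> h; rewrite -!mulrDl h !mul0r.
have antiF : {in swords true n.+3, forall s,
    (2 * FC s - FB s - 'X) * M s * (2 * EC s - 'X) +
    (2 * FC (flip_head s) - FB (flip_head s) - 'X) * M (flip_head s)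
     * (2 * EC (flip_head s) - 'X) = 0}.
  move=> s sP; have [a [[|b u] [c [sE //= _]]]] := sword_cons_rconsP sP.
  (* The last two letters of [revN s] are the negated second and first letters of s. *)
  have [v [y [x [+ _ xy x0 y0]]]] := sword_rcons2P (revN_sword sP).
  have h := LC_LB_flip xy x0 y0.
  rewrite {}sE /= !revN_cons => /rcons_inj[] /rcons_inj[_ yE] xE.

  rewrite -rcons_cons /FC /FB /M /EC !mid_cons_rcons /= yE xE.
  exact: alg h.
have := sum_swords_anti flip_lastK (@flip_last_sword _) antiE.
have := sum_swords_anti flip_headK (@flip_head_sword _) antiF.
move=> e1 e2.
have pw : {in swords true n.+3, forall s, [/\ wtC s = FC s * M s * EC s,
    wt 0 (init s) = FC s * M s & wt0 (rcons (behead s) 0) = M s * EC s]}.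
  move=> s sP; have [a [u [c [-> szu]]]] := sword_cons_rconsP sP.
  case: u szu => // b u _; rewrite /FC /M /EC /wtC mid_cons_rcons.
  rewrite -rcons_cons init_rcons /= !last_rcons LCN /LC !wt_rcons !last_rcons.
  by split; ring.
have eC : \sum_(s <- swords true n.+3) wtC s =
    \sum_(s <- swords true n.+3) FC s * M s * EC s.
  by apply: eq_big_seq => s /pw[].
have eL : \sum_(s <- swords true n.+3) wt 0 (init s) =
    \sum_(s <- swords true n.+3) FC s * M s.
  by apply: eq_big_seq => s /pw[].
(* Reversal with negation turns words preceded by a zero into words followed by a zero, so the two
   mixed terms of the expansion have equal sums. *)
have eR : \sum_(s <- swords true n.+3) wt 0 (init s) =
    \sum_(s <- swords true n.+3) M s * EC s.
  rewrite -(sum_swords_inv _ revNK (@revN_sword _)).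
  apply: eq_big_seq => s sP; rewrite init_revN; have [_ _ <-] := pw _ sP.
  by rewrite -[LHS]/(wt0 (0 :: _)) -wt0_revN revN_cons revNK oppr0.
have : \sum_(s <- swords true n.+3) (wtD s - 4 * (FC s * M s * EC s)
    + 2 * 'X * (FC s * M s) + 2 * 'X * (M s * EC s) - 'X ^+ 2 * M s) = 0.
  rewrite (eq_bigr (fun s => - ((2 * FC s - FB s - 'X) * M s * (2 * EC s - 'X))
    - FB s * M s * (2 * EC s - EB s - 'X))); last first.
    by move=> s _; rewrite /wtD -/(FB s) -/(M s) -/(EB s); ring.
  by rewrite big_split /= !sumrN e1 e2 oppr0 addr0.
rewrite sumrB !big_split /= sumrN -!mulr_sumr -eR -eC -eL.
rewrite /M sum_wt0_mid (sum_swords_init _ ins_wt_from0).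
set C := \sum_(s <- _) _; set B := \sum_(s <- _) _; set E := \sum_(s <- _) _.
have alg2 (d c x k b l e : {poly rat}) :
    d - 4 * c + 2 * x * (k * b) + 2 * x * (k * b) - x ^+ 2 * (l * e) = 0 ->
    d = 4 * c - 4 * k * x * b + l * x ^+ 2 * e.
  by move=> h; rewrite -[RHS]addr0 -h; ring.
exact: alg2.
Qed.

(** * Signed permutations as words *)

Lemma size_swords b n : size (swords b n) = (b.+1 ^ n * n`!)%N.
Proof.
elim: n => // n IHn; rewrite [LHS]size_allpairs IHn size_allpairs size_iota.
by case: b {IHn} => /=; rewrite factS !expnS; lia.
Qed.

Lemma perm_iota_ord n (f : 'I_n -> 'I_n) : injective f ->
  perm_eq [seq (f j).+1 | j : 'I_n] (iota 1 n).
Proof.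
move=> fI; have U : uniq [seq (f j).+1 | j : 'I_n].
  by rewrite map_inj_uniq ?enum_uniq // => i j [/val_inj/fI].
have S : {subset [seq (f j).+1 | j : 'I_n] <= iota 1 n}.
  by move=> _ /mapP[j _ ->]; rewrite mem_iota /= add1n ltnS.
apply: (uniq_perm U (iota_uniq _ _)).
by have [] := uniq_min_size U S; rewrite // size_map size_iota size_enum_ord.
Qed.

(** Injectivity suffices for a bijection, since both sides have n! elements ([size_swords]). *)
Lemma sum_wordA n (F : seq int -> {poly rat}) :
  \sum_(w : 'S_n) F (map Posz (wordA w)) = \sum_(s <- swords false n) F s.
Proof.
pose g (w : 'S_n) := map Posz (wordA w).
have U : uniq (map g (enum 'S_n)).
  have PI : injective Posz by move=> i j [].
  rewrite map_inj_uniq ?enum_uniq // => w w' /(inj_map PI) /eq_in_map e.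
  apply/permP => j; apply: val_inj.
  by have /= [] := e j (mem_enum _ _).
have S : {subset map g (enum 'S_n) <= swords false n}.
  move=> _ /mapP[w _ ->]; rewrite mem_swords /is_sword /g -map_comp map_id.
  rewrite perm_iota_ord ?all_map /=; last exact: perm_inj.
  by apply/allP.
have szE : (size (swords false n) <= size (map g (enum 'S_n)))%N.
  by rewrite size_swords exp1n mul1n size_map -cardE card_Sn.
have [_ e] := uniq_min_size U S szE.
rewrite -(perm_big _ (uniq_perm U (swords_uniq _ _) e)) big_map.
by rewrite big_enum.
Qed.

Lemma signed_permP n (w : {perm pm n}) x :
  w \in signed_perms n -> w (pm_opp x) = pm_opp (w x).
Proof. by rewrite inE => /forallP/(_ x)/eqP. Qed.

Lemma absz_pm_val n (x : pm n) : absz (pm_val x) = x.2.+1.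
Proof. by rewrite /pm_val abszMsign. Qed.

Lemma pm_val_lt0 n (x : pm n) : (pm_val x < 0) = x.1.
Proof. by case: x => [[] i]; rewrite /pm_val /= ?expr1 ?expr0; lia. Qed.

Lemma pm_val_inj n : injective (@pm_val n).
Proof.
move=> x y e; have := congr1 absz e; rewrite !absz_pm_val => -[/val_inj].
have := congr1 (fun a => a < 0) e; rewrite !pm_val_lt0.
by case: x y {e} => [? ?] [? ?] /= -> ->.
Qed.

Lemma signed_word_inj n : {in signed_perms n &, injective (@word n)}.
Proof.
move=> w w' wS w'S /eq_in_map e.
have e0 j : w (false, j) = w' (false, j).
  by apply: pm_val_inj; apply: e; rewrite mem_enum.
apply/permP => -[[] j] //; have -> : (true, j) = pm_opp (false, j) by [].
by rewrite !signed_permP // e0.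
Qed.

Lemma word_sword n w : w \in signed_perms n -> word w \in swords true n.
Proof.
move=> wS; rewrite mem_swords /is_sword andbT -map_comp.
rewrite (eq_map (g := fun j => (w (false, j)).2.+1)); last first.
  by move=> j /=; rewrite absz_pm_val.
apply: perm_iota_ord => i j e.
have [|] := eqVneq (w (false, i)) (w (false, j)); first by move=> /perm_inj[].
move=> ne; suff /perm_inj[] : w (false, i) = w (true, j) by [].
have -> : (true, j) = pm_opp (false, j) by [].
rewrite signed_permP //; move: ne e.
case: (w (false, i)) (w (false, j)) => [s a] [s' a'] /= + e; rewrite -{}e => ne.
by rewrite /pm_opp /=; congr pair; case: s s' ne => -[]; rewrite ?eqxx.
Qed.

Lemma sword_word n s : s \in swords true n ->
  exists2 w, w \in signed_perms n & word w = s.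
Proof.
rewrite mem_swords => sP; have szs := size_is_sword sP.
have bnd (j : 'I_n) : (0 < absz (nth 0%R s j) <= n)%N.
  by apply: (is_sword_bound sP); rewrite mem_nth // szs.
have bnd' (j : 'I_n) : ((absz (nth 0%R s j)).-1 < n)%N.
  by case/andP: (bnd j) => h; rewrite -ltnS prednK.
pose a j := Ordinal (bnd' j).
(* The sign of the letter is added to the sign of the argument, which makes f commute with [pm_opp];
   the shift to [.-1] matches the encoding of i + 1 by i. *)
pose f (x : pm n) : pm n := (x.1 (+) (nth 0 s x.2 < 0)%R, a x.2).
have fI : injective f.
  move=> [e i] [e' j] [] /= + e2.
  have ij : i = j.
    have := is_sword_uniq sP => /(uniqP 0%N)/(_ i j); rewrite !inE size_map szs.
    move=> /(_ (ltn_ord i) (ltn_ord j)); rewrite !(nth_map 0) ?szs //.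
    move=> h; apply: val_inj; apply: h; move: (bnd i) (bnd j) e2.
    by case: (absz _) => // p; case: (absz _) => // q _ _ /= ->.
  by rewrite ij => /addIb ->.
exists (perm fI).
  by rewrite inE; apply/forallP => -[e i]; rewrite !permE /f /pm_opp /= addNb.
apply: (@eq_from_nth _ 0); first by rewrite size_map size_enum_ord.
rewrite size_map size_enum_ord => i iP.
rewrite (nth_map (Ordinal iP)) ?size_enum_ord // (nth_ord_enum _ (Ordinal iP)).
rewrite permE /f /pm_val /=.
have := bnd (Ordinal iP) => /= /andP[h _]; rewrite prednK //.
exact: esym (intEsign _).
Qed.

Lemma sum_word n (P : pred (seq int)) (F : seq int -> {poly rat}) :
  \sum_(w in signed_perms n | P (word w)) F (word w) =
  \sum_(s <- swords true n | P s) F s.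
Proof.
have U : uniq (map (@word n) (enum (signed_perms n))).
  rewrite map_inj_in_uniq ?enum_uniq // => w w'; rewrite !mem_enum.
  exact: signed_word_inj.
have e : map (@word n) (enum (signed_perms n)) =i swords true n.
  move=> s; apply/mapP/idP => [[w]|/sword_word[w wP <-]].
    by rewrite mem_enum => wP ->; exact: word_sword.
  by exists w; rewrite ?mem_enum.
rewrite -(perm_big _ (uniq_perm U (swords_uniq _ _) e)) big_map.
by rewrite big_enum_cond.
Qed.

Lemma wt_sum x s :
  'X^(\sum_(0 <= i < size s | (nth 0%R (x :: s) i > nth 0%R s i)%R) 1)%N = wt x s.
Proof.
elim: s x => [|y s IHs] x; first by rewrite big_nil expr0.
rewrite /= big_mkcond big_nat_recl //= -big_mkcond exprD IHs.
by rewrite dwE; case: ifP; rewrite ?expr1 ?expr0.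
Qed.

Lemma size_word n (w : {perm pm n}) : size (word w) = n.
Proof. by rewrite size_map size_enum_ord. Qed.

Lemma affdesC_word n (w : {perm pm n}) : 'X^(affdesC w) = wtC (word w).
Proof.
rewrite /affdesC /letter exprD big_add1 /=; have := size_word w.
move: (word w) => s <-.
by rewrite wt_sum /wtC wt_rcons (last_nth 0).
Qed.

Lemma affdesB_word n (w : {perm pm n.+1}) : 'X^(affdesB w) = wtB (word w).
Proof.
rewrite /affdesB exprD big_add1 /= -{1}(size_word w) wt_sum.
rewrite /letter /wtB; have := size_word w; move: (word w) => s.
case/lastP: s => // s x; rewrite size_rcons => -[<-] /=.
rewrite init_rcons last_rcons wt_rcons /LB mulrA; congr (_ * 'X^ _).
rewrite nth_rcons ltnn eqxx -rcons_cons nth_rcons /= ltnS leqnn.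
by rewrite (last_nth 0).
Qed.

Lemma affdesD_word n (w : {perm pm n.+3}) : 'X^(affdesD w) = wtD (word w).
Proof.
rewrite /affdesD !exprD; have := size_word w.
rewrite /letter; move: (word w) => s; case: s => // a s.
case/lastP: s => // u c; rewrite /= size_rcons => -[szu].
rewrite 2!big_add1 /=.
have -> : 'X^(\sum_(0 <= i < n.+2 | (nth 0%R (a :: rcons u c) i
    > nth 0%R (rcons u c) i)%R) 1)%N = wt a (rcons u c).
  by rewrite -wt_sum size_rcons szu.
rewrite /wtD mid_cons_rcons /= last_rcons.
case: u szu => // b u [<-].
rewrite /= nth_rcons ltnn eqxx -rcons_cons nth_rcons /= ltnS leqnn -(last_nth 0).
have -> : (a + b < 0) = (0 < - b - a) by lia.
rewrite -[LHS]/(wt a (rcons (b :: u) c) * dw (- b - a) 0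
  * dw (last b u + c) 0).
by rewrite wt_rcons /LB dwN /=; ring.
Qed.

Lemma affine_CE n : affine_C n = \sum_(s <- swords true n) wtC s.
Proof.
rewrite -(sum_word _ xpredT); apply: eq_big => w; first by rewrite andbT.
by rewrite affdesC_word.
Qed.

Lemma affine_BE n : affine_B n.+1 = \sum_(s <- swords true n.+1) wtB s.
Proof.
rewrite -(sum_word _ xpredT); apply: eq_big => w; first by rewrite andbT.
by rewrite affdesB_word.
Qed.

Lemma affine_DE n : affine_D n.+3 =
  \sum_(s <- swords true n.+3 | ~~ odd (count (fun a => a < 0) s)) wtD s.
Proof.
rewrite -sum_word; apply: eq_big => w; first by rewrite inE.
by rewrite affdesD_word.
Qed.

(** * Type D: changing the sign of the letter 1 or -1 *)

Definition flip1 (x : int) : int := if absz x == 1%N then - x else x.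

Lemma flip1K : involutive flip1.
Proof.
move=> x; rewrite /flip1.
by case h: (absz x == 1%N); rewrite ?abszN h ?opprK.
Qed.

Lemma absz_flip1 x : absz (flip1 x) = absz x.
Proof. by rewrite /flip1; case: ifP; rewrite ?abszN. Qed.

Lemma map_flip1_sword n :
  {in swords true n, forall s, map flip1 s \in swords true n}.
Proof.
move=> s; apply: sword_perm_abs; rewrite -map_comp.
by rewrite (eq_map (g := absz)) // => x; exact: absz_flip1.
Qed.

(** The sign of x - y is governed by the letter of larger absolute value, which is at least 2 and
    hence fixed by [flip1]. The same holds for x + y in [dwD_flip1]. *)
Lemma dw_flip1 x y : absz x != absz y -> x != 0 -> y != 0 ->
  dw (flip1 x) (flip1 y) = dw x y.
Proof.
move=> xy x0 y0; rewrite /flip1 !dwE; congr (if _ then _ else _).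
by case: (eqVneq (absz x) 1%N) => ?; case: (eqVneq (absz y) 1%N) => ?; lia.
Qed.

Lemma dwD_flip1 x y : absz x != absz y -> x != 0 -> y != 0 ->
  dw (flip1 x + flip1 y) 0 = dw (x + y) 0.
Proof.
move=> xy x0 y0; rewrite /flip1 !dwE; congr (if _ then _ else _).
by case: (eqVneq (absz x) 1%N) => ?; case: (eqVneq (absz y) 1%N) => ?; lia.
Qed.

Lemma wt_flip1 x s : uniq (map absz (x :: s)) -> 0 \notin x :: s ->
  wt (flip1 x) (map flip1 s) = wt x s.
Proof.
elim: s x => // y s IHs x; rewrite [map _ _]/= cons_uniq => /andP[xP yP].
rewrite inE negb_or eq_sym => /andP[x0 ys0] /=.
rewrite IHs // dw_flip1 //.
  by move: xP; rewrite inE negb_or => /andP[].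
by move: ys0; rewrite inE negb_or eq_sym => /andP[].
Qed.

Lemma odd_neg_flip1 s : 0 \notin s ->
  odd (count (fun a => a < 0) (map flip1 s)) =
  odd (count (fun a => a < 0) s) (+) odd (count_mem 1%N (map absz s)).
Proof.
elim: s => // x s IHs; rewrite inE negb_or => /andP[x0 /IHs e].
rewrite /= !oddD e !oddb.
have -> : (flip1 x < 0) = (x < 0) (+) (absz x == 1%N).
  by rewrite /flip1; case: eqVneq => ?; lia.
by rewrite !addbA; congr (_ (+) _); rewrite -!addbA; congr (_ (+) _); rewrite addbC.
Qed.

Lemma flip1N x : flip1 (- x) = - flip1 x.
Proof. by rewrite /flip1 abszN; case: ifP. Qed.

Lemma LB_flip1 x y : absz y != absz x -> x != 0 -> y != 0 ->
  LB (flip1 x) (flip1 y) = LB x y.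
Proof. by rewrite eq_sym => xy x0 y0; rewrite /LB dw_flip1 // dwD_flip1. Qed.

Lemma wtD_flip1 n s : s \in swords true n.+3 -> wtD (map flip1 s) = wtD s.
Proof.
move=> sP; have [a [u [c [sE]]]] := sword_cons_rconsP sP.
case: u sE => // b u sE _.
move: sP; rewrite mem_swords => sP.
have nz x : x \in s -> x != 0.
  by move=> /(is_sword_bound sP) /andP[]; rewrite absz_gt0.
have := is_sword_uniq sP; rewrite {}sE {sP} in nz *.
rewrite map_cons cons_uniq map_rcons rcons_uniq mem_rcons.
case/and3P=> aP cP bP.
have a0 : a != 0 by apply: nz; rewrite mem_head.
have b0 : b != 0 by apply: nz; rewrite !inE eqxx orbT.
have c0 : c != 0 by apply: nz; rewrite inE mem_rcons mem_head orbT.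
have l0 : last b u != 0.
  by apply: nz; rewrite inE mem_rcons [in X in _ || X]inE mem_last !orbT.
rewrite map_cons map_rcons /wtD !mid_cons_rcons /= !last_rcons last_map.
rewrite -!flip1N !LB_flip1 ?oppr_eq0 ?abszN // ?wt_flip1 //.
- apply/negP => h; have /eqP// : (0 : int) != 0.
  by apply: nz; rewrite inE mem_rcons [in X in _ || X]inE h !orbT.
- by apply: contraNneq cP => ->; rewrite (map_f absz) // mem_last.
- by apply: contraNneq aP => ->; rewrite !inE eqxx orbT.
Qed.

(** [flip1] preserves [wtD] and changes the parity of the number of negative letters, so words of
    either parity have the same total weight. *)
Lemma two_affine_D n : 2 * affine_D n.+3 = \sum_(s <- swords true n.+3) wtD s.
Proof.
pose ev (s : seq int) := ~~ odd (count (fun a => a < 0) s).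
pose G s := if ev s then wtD s else 0.
rewrite affine_DE -/ev [RHS](bigID ev) /=.
suff -> : \sum_(s <- swords true n.+3 | ~~ ev s) wtD s =
    \sum_(s <- swords true n.+3 | ev s) wtD s by ring.
rewrite [RHS]big_mkcond -[RHS](sum_swords_inv G (mapK flip1K)); last first.
  exact: map_flip1_sword.
rewrite big_mkcond; apply: eq_big_seq => s sP; rewrite /G (wtD_flip1 sP).
suff -> : ev (map flip1 s) = ~~ ev s by [].
move: sP; rewrite mem_swords => sP.
rewrite /ev odd_neg_flip1; last by apply/negP => /(is_sword_bound sP).
rewrite count_uniq_mem ?(is_sword_uniq sP) //.
case/andP: sP => /perm_mem -> _; rewrite mem_iota /=.
by rewrite addbT.
Qed.

(** * Type A and exponential generating functions *)

Definition wtA (s : seq int) := wt (last 0 s) s.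

Lemma affdesA_word n (w : 'S_n) : 'X^(affdesA w) = wtA (map Posz (wordA w)).
Proof.
have szw : size (wordA w) = n by rewrite size_map size_enum_ord.
rewrite /wtA (last_map Posz _ 0%N) -wt_sum size_map szw; congr 'X^ _.
rewrite /affdesA -sum1dep_card big_mkord; apply: eq_bigl => i.
by rewrite /letterA -map_cons !(nth_map 0%N) ?szw //= ?szw ?ltnS 1?ltnW.
Qed.

Lemma affine_AE n : affine_A n = \sum_(s <- swords false n.+1) wtA s.
Proof.
by rewrite -sum_wordA; apply: eq_bigr => w _; rewrite affdesA_word.
Qed.

(** Inserting the maximum before the last letter treats the word cyclically, with as many slots as
    letters, hence al = 0. Appended at the end, the maximum acts like the two zeros of [wtC]: one of
    its two comparisons is a descent. Since [ins_op 1 0 n.+1] and [ins_op 1 'X n] coincide, the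
    induction closes. *)
Lemma sum_wtA n : \sum_(s <- swords false n.+1) wtA s =
  n.+1%:R * \sum_(s <- swords false n) wtC s.
Proof.
elim: n => [|n IHn].
  rewrite big_swords !big_seq1 big_ord1 big_seq1 /wtA /wtC /= !dwE /=.
  by ring.
have step : {in swords false n.+1, forall w,
    \sum_(i < n.+2) \sum_(x <- sletters false n.+2) wtA (ins i x w) =
    ins_op 1 0 n.+1 (wtA w) + wtC w}.
  move=> w; rewrite mem_swords => wP; have szw := size_is_sword wP.
  have wN y : y \in w -> (absz y < n.+2)%N by move=> /(is_sword_bound wP)/andP[].
  under eq_bigr => i _ do rewrite big_seq1.
  rewrite big_ord_recr /=; congr (_ + _).
    have lastw (i : 'I_n.+1) : last 0 (ins i n.+2%:Z w) = last 0 w.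
      rewrite -{2}(cat_take_drop i w) !last_cat /=.
      case: (drop i w) (size_drop i w) => //= /esym/eqP.
      by rewrite subn_eq0 szw leqNgt ltn_ord.
    under eq_bigr => i _ do rewrite /wtA lastw.
    have := @wt_ins n.+2 n.+2%:Z (last 0 w) w erefl; rewrite szw => ->.
      by rewrite /ins_op /wtA mul1n; ring.
    move=> y; rewrite inE => /predU1P[->|/wN //]; apply: wN.
    by case: (w) szw => //= a s _; exact: mem_last.
  have -> : ins n.+1 n.+2%:Z w = rcons w n.+2%:Z by rewrite -szw ins_size.
  rewrite /wtA last_rcons /wtC; have w0 y : y \in w -> 0 < y.
    move=> yw; have := is_sword_bound wP yw; case/andP: wP => _ /= /allP/(_ y yw).
    by lia.
  case: w {wP} szw wN w0 => // x s _ wN w0.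
  have xP := w0 _ (mem_head _ _); have lP := w0 _ (mem_last x s).
  have xN := wN _ (mem_head _ _); have lN := wN _ (mem_last x s).
  rewrite /= !wt_rcons !dwE.
  have -> : (x < n.+2%:Z) = true by lia.
  have -> : (n.+2%:Z < last x s) = false by lia.
  have -> : (x < 0) = false by lia.
  by rewrite lP; ring.
rewrite big_swords (eq_big_seq _ step) big_split /= -ins_op_sum IHn.
rewrite (sum_swordsS _ (@ins_wtC false)) /ins_op derivM.
rewrite -[n.+1%:R in X in X + _]polyC_natr derivC polyC_natr !mul1n -!natr1.
by ring.
Qed.

(** * Solving the insertion recurrences *)

Lemma sum_binS (R : comNzRingType) n (f : nat -> R) :
  \sum_(k < n.+2) 'C(n.+1, k)%:R * f k =
  \sum_(k < n.+1) 'C(n, k)%:R * f k + \sum_(k < n.+1) 'C(n, k)%:R * f k.+1.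
Proof.
rewrite big_ord_recl bin0.
under eq_bigr => i _ do rewrite lift0 binS natrD mulrDl.
rewrite big_split /= addrA; congr (_ + _).
rewrite [in RHS]big_ord_recl bin0 [in LHS]big_ord_recr /= bin_small // mul0r addr0.
by congr (_ + _); apply: eq_bigr => i _.
Qed.

(** This is the coefficient of z^n / n! in exp(u z) times the exponential generating function of
    p. *)
Definition exp_conv (u : {poly rat}) (p : nat -> {poly rat}) (n : nat) :=
  \sum_(k < n.+1) 'C(n, k)%:R * (u ^+ k * p (n - k)%N).

(** Coefficientwise form of the fact that t exp(m (1 - t) z) is annihilated by the derivation
    underlying the recurrence; Pascal's rule replaces differentiation in z. *)
Lemma ins_op_exp_conv m al p :
  (forall n, p n.+1 = ins_op m al n (p n)) ->
  let r n := p n - 'X * exp_conv (m%:R * (1 - 'X)) p n in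
  forall n, r n.+1 = ins_op m al n (r n).
Proof.
move=> pS r n; rewrite /r pS {r}; set u := m%:R * (1 - 'X).
suff : 'X * exp_conv u p n.+1 = ins_op m al n ('X * exp_conv u p n).
  by rewrite /ins_op derivB => ->; ring.
rewrite /exp_conv (sum_binS n (fun k => u ^+ k * p (n.+1 - k)%N)).
rewrite !mulr_sumr ins_op_sum mulrDr !mulr_sumr -big_split /=.
apply: eq_bigr => k _; have kn := leq_ord k.
rewrite subSS subSn // pS /ins_op.
(* u is a constant multiple of 1 - X, so (1 - X) (u^k)' = - k u^k; the derivative of u^k enters the
   goal only multiplied by 1 - X. *)
have du : (u ^+ k)^`() * (1 - 'X) = - k%:R * u ^+ k.
  have uD : u^`() = - m%:R.
    by rewrite /u -polyC_natr deriv_mulC derivB derivX derivC -polyCN; ring.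
  case: (nat_of_ord k) => [|j]; first by rewrite expr0 derivC; ring.
  by rewrite deriv_exp uD exprS /u -mulr_natl; ring.
have -> : (m * n)%:R = m%:R * k%:R + m%:R * (n - k)%:R :> {poly rat}.
  by rewrite -mulrDr -natrD subnKC // natrM.
rewrite !derivM derivX (_ : (_%:R)^`() = 0) ?natrM; last first.
  by rewrite -polyC_natr derivC.
set d := (u ^+ k)^`() in du *.
have e (c x v q q' al' mm kk l v' : {poly rat}) : d * (1 - x) = - kk * v ->
   v' = mm * (1 - x) ->
   x * (c * (v * (mm * x * (1 - x) * q' + (al' + mm * l * x) * q)))
    + x * (c * (v' * v * q))
   = mm * x * (1 - x)
       * (1 * (c * (v * q)) + x * (0 * (v * q) + c * (d * q + v * q')))
     + (al' + (mm * kk + mm * l) * x) * (x * (c * (v * q))).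
  move=> h ->.
  have -> : mm * x * (1 - x)
       * (1 * (c * (v * q)) + x * (0 * (v * q) + c * (d * q + v * q')))
    = mm * x * (1 - x) * (c * v * q + x * c * v * q')
      + mm * x * x * c * q * (d * (1 - x)).
    by ring.
  by rewrite h; ring.
rewrite exprS; exact: e du erefl.
Qed.

(** Starting from 1 - X, one step gives - m X (1 - X) + m X (1 - X) = 0, and zero persists. *)
Lemma cyclic_recurrence m p : p 0%N = 1 ->
  (forall n, p n.+1 = ins_op m (m%:R * 'X) n (p n)) ->
  forall n, p n - 'X * exp_conv (m%:R * (1 - 'X)) p n = (1 - 'X) *+ (n == 0)%N.
Proof.
move=> p0 pS; have rS := ins_op_exp_conv pS.
case=> [|n]; first by rewrite /exp_conv big_ord1 subnn bin0 p0 expr0 !mulr1.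
rewrite -[RHS]/(0 : {poly rat}); elim: n => [|n IHn]; rewrite rS.
  2: by rewrite IHn /ins_op derivC; ring.
rewrite /exp_conv big_ord1 subnn bin0 p0 expr0 !mul1r mulr1 /ins_op.
by rewrite derivB derivX derivC muln0; ring.
Qed.

Lemma half_recurrence p : p 0%N = 1 ->
  (forall n, p n.+1 = ins_op 2 (1 + 'X) n (p n)) ->
  forall n, p n - 'X * exp_conv (2 * (1 - 'X)) p n = (1 - 'X) * (1 - 'X) ^+ n.
Proof.
move=> p0 pS; have rS := ins_op_exp_conv pS.
elim=> [|n IHn]; first by rewrite /exp_conv big_ord1 subnn bin0 p0 !expr0; ring.
rewrite rS IHn -exprS /ins_op deriv_exp derivB derivX derivC sub0r natrM.
by rewrite -mulr_natl -natr1 !exprS; ring.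
Qed.

(** * Calculus of exponential generating functions *)

Lemma Qt_natr_neq0 n : (0 < n)%N -> n%:R != 0 :> Qt.
Proof.
move=> n0; rewrite -(rmorph_nat (@tofrac _)) tofrac_eq0 -polyC_natr.
by rewrite polyC_eq0 pnatr_eq0 -lt0n.
Qed.

Notation egf := (egf_from 0).

Lemma fcoef_egf P n : fcoef (egf P) n = tofrac (P n) / n`!%:R.
Proof. by []. Qed.

Lemma eq_egf P Q : P =1 Q -> egf P = egf Q.
Proof. by move=> PQ; apply/fpsP => n; rewrite !fcoef_egf PQ. Qed.

Lemma fps_egf_mul (F : fieldType) (P Q : nat -> F) :
  (forall n, (0 < n)%N -> n%:R != 0 :> F) ->
  Fps (fun n => P n / n`!%:R) * Fps (fun n => Q n / n`!%:R) =
  Fps (fun n => (\sum_(k < n.+1) 'C(n, k)%:R * (P k * Q (n - k)%N)) / n`!%:R).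
Proof.
move=> char0; apply/fpsP => n; rewrite fcoefM /= mulr_suml.
apply: eq_bigr => k _; have kn := leq_ord k; rewrite -(bin_fact kn) !natrM.
have h1 := char0 _ (fact_gt0 k); have h2 := char0 _ (fact_gt0 (n - k)).
have h3 : 'C(n, k)%:R != 0 :> F by rewrite char0 // bin_gt0.
by field; rewrite h1 h2 h3.
Qed.

Lemma egfM P Q : egf P * egf Q =
  egf (fun n => \sum_(k < n.+1) 'C(n, k)%:R * (P k * Q (n - k)%N)).
Proof.
pose p n := tofrac (P n); pose q n := tofrac (Q n).
apply: etrans (fps_egf_mul p q Qt_natr_neq0) _.
apply/fpsP => n; rewrite fcoef_egf [LHS]/=; congr (_ / _).
by rewrite rmorph_sum; apply: eq_bigr => k _; rewrite !rmorphM rmorph_nat.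
Qed.

Lemma fcoefCM (R : comNzRingType) (c : R) f n : fcoef (fpsC c * f) n = c * fcoef f n.
Proof.
rewrite fcoefM big_ord_recl subn0 big1 ?addr0 // => i _.
by rewrite fcoefC mul0r.
Qed.

Lemma egfZ p P : fpsC (tofrac p) * egf P = egf (fun n => p * P n).
Proof. by apply/fpsP => n; rewrite fcoefCM !fcoef_egf rmorphM mulrA. Qed.

Lemma egfB P Q : egf P - egf Q = egf (fun n => P n - Q n).
Proof.
by apply/fpsP => n; rewrite fcoefD fcoefN !fcoef_egf rmorphB mulrBl.
Qed.

Lemma fcoefXM (R : comNzRingType) (f : fps R) n :
  fcoef (fpsX R * f) n = if n is m.+1 then fcoef f m else 0.
Proof.
rewrite fcoefM; case: n => [|n]; first by rewrite big_ord1 /= mul0r.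
rewrite 2!big_ord_recl big1 => [|i _]; last by rewrite /= mul0r.
by rewrite /= mul0r add0r mul1r addr0 subSS subn0.
Qed.

Lemma egf1 p : egf (fun n => p *+ (n == 0)%N) = fpsC (tofrac p).
Proof.
apply/fpsP => -[|n]; rewrite fcoef_egf fcoefC /=; first by rewrite divr1.
by rewrite rmorph0 mul0r.
Qed.

Lemma fcoef_expCX (R : comNzRingType) (c : R) k n :
  fcoef ((fpsC c * fpsX R) ^+ k) n = c ^+ k *+ (n == k).
Proof.
elim: k n => [|k IHk] n; first by rewrite !expr0 fcoef1.
rewrite exprS -mulrA fcoefCM fcoefXM; case: n => [|n]; first by rewrite mulr0.
by rewrite IHk eqSS mulrnAr -exprS.
Qed.

Lemma fps_exp_egf u : fps_exp (fpsC (tofrac u) * z) = egf (fun n => u ^+ n).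
Proof.
apply/fpsP => n; rewrite fcoef_egf /= big_ord_recr big1 /= => [|k _].
  by rewrite add0r fcoef_expCX eqxx rmorphXn.
by rewrite fcoef_expCX gtn_eqF // mul0r.
Qed.

(** [cycP true] is the affine polynomial of type C; for n >= 1, [cycP false] is X times the descent
    polynomial of the symmetric group. [halfP] is the descent polynomial of the finite group of
    signed permutations. *)
Definition cycP (b : bool) (n : nat) : {poly rat} := \sum_(s <- swords b n) wtC s.
Definition halfP (n : nat) : {poly rat} := \sum_(s <- swords true n) wt 0 s.

Lemma cycP0 b : cycP b 0 = 1.
Proof. by rewrite /cycP big_seq1 /wtC /= dwE ltxx mulr1. Qed.

Lemma cycPS b n : cycP b n.+1 = ins_op b.+1 (b.+1%:R * 'X) n (cycP b n).
Proof. exact: sum_swordsS (@ins_wtC b). Qed.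

Lemma cycP1 : cycP true 1 = 2 * 'X.
Proof. by rewrite cycPS cycP0 /ins_op derivC muln0 -[true.+1]/2%N; ring. Qed.

Lemma halfP0 : halfP 0 = 1.
Proof. by rewrite /halfP big_seq1. Qed.

Lemma halfPS n : halfP n.+1 = ins_op 2 (1 + 'X) n (halfP n).
Proof. exact: sum_swordsS ins_wt_from0. Qed.

(** Multiplication by X turns the recurrence with al = 2 into the one with al = 2 X. This expresses
    the last sum in [sum_wtD] by type C; the empty word is excluded, as its weight is 1 on both
    sides before multiplication. *)
Lemma cycP_open n : cycP true n.+1 = 'X * \sum_(s <- swords true n.+1) wt0 s.
Proof.
elim: n => [|n IHn]; rewrite cycPS (sum_swordsS _ ins_wt0) -[true.+1]/2%N.
  by rewrite cycP0 big_seq1 /ins_op /= derivC muln0; ring.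
by rewrite IHn /ins_op derivM derivX; ring.
Qed.

Lemma egf_denM u P :
  egf P * (1 - t * fps_exp (fpsC (tofrac u) * z)) =
  egf (fun n => P n - 'X * exp_conv u P n).
Proof.
rewrite fps_exp_egf mulrBr mulr1 mulrCA [egf P * _]mulrC egfM egfZ egfB.
by [].
Qed.

Lemma fpsCB (R : comNzRingType) (c d : R) : fpsC (c - d) = fpsC c - fpsC d.
Proof. by apply/fpsP => n; rewrite fcoefD fcoefN !fcoefC mulrnBl. Qed.

Lemma fpsC1 (R : comNzRingType) : fpsC (1 : R) = 1.
Proof. by []. Qed.

Lemma fpsC_nat (R : comNzRingType) k : fpsC (k%:R : R) = k%:R.
Proof.
apply/fpsP => n; rewrite fcoefC.
elim: k => [|k IHk]; first by rewrite mul0rn.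
by rewrite -!natr1 fcoefD -IHk mulrnDl fcoef1; case: (n == 0)%N.
Qed.

Lemma fpsC_tofrac_nat k : fpsC (tofrac (k%:R : {poly rat})) = k%:R.
Proof. by rewrite rmorph_nat fpsC_nat. Qed.

Lemma fpsC_tofrac_1X : fpsC (tofrac (1 - 'X : {poly rat})) = 1 - t.
Proof. by rewrite rmorphB rmorph1 fpsCB fpsC1. Qed.

Lemma fpsCM (R : comNzRingType) (c d : R) : fpsC (c * d) = fpsC c * fpsC d.
Proof. by apply/fpsP => n; rewrite fcoefCM !fcoefC mulrnAr. Qed.

Lemma exp_arg_unsigned : z * (1 - t) = fpsC (tofrac (1 - 'X)) * z.
Proof. by rewrite fpsC_tofrac_1X mulrC. Qed.

Lemma exp_arg_signed : 2 * z * (1 - t) = fpsC (tofrac (2 * (1 - 'X))) * z.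
Proof.
by rewrite rmorphM fpsCM fpsC_tofrac_1X (fpsC_tofrac_nat 2) mulrAC.
Qed.

Lemma egf_cycP b : egf (cycP b) =
  (1 - t) / (1 - t * fps_exp (fpsC (tofrac (b.+1%:R * (1 - 'X))) * z)).
Proof.
apply: canRL (mulrK (den_unit _)) _; rewrite egf_denM.
rewrite (eq_egf (cyclic_recurrence (cycP0 b) (cycPS b))) egf1.
exact: fpsC_tofrac_1X.
Qed.

Lemma egf_halfP : egf halfP =
  (1 - t) * fps_exp (z * (1 - t)) / (1 - t * fps_exp (2 * z * (1 - t))).
Proof.
apply: canRL (mulrK (den_unit _)) _; rewrite exp_arg_unsigned exp_arg_signed egf_denM.
by rewrite (eq_egf (half_recurrence halfP0 halfPS)) -egfZ fps_exp_egf fpsC_tofrac_1X.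
Qed.

Lemma egfD P Q : egf P + egf Q = egf (fun n => P n + Q n).
Proof. by apply/fpsP => n; rewrite fcoefD !fcoef_egf rmorphD mulrDl. Qed.

Lemma egfX P : z * egf P = egf (fun n => n%:R * P n.-1).
Proof.
apply/fpsP => -[|n]; rewrite fcoefXM fcoef_egf; first by rewrite mul0r rmorph0 mul0r.
rewrite fcoef_egf rmorphM rmorph_nat factS natrM invfM mulrACA divff ?mul1r //.
exact: Qt_natr_neq0.
Qed.

Lemma egf_fromE m P : egf_from m P = egf (fun n => if (m <= n)%N then P n else 0).
Proof.
apply/fpsP => n; rewrite fcoef_egf /=; case: ifP => // _.
by rewrite rmorph0 mul0r.
Qed.

Definition delta0 (n : nat) : {poly rat} := (n == 0)%:R.

Lemma egf_one : 1 = egf delta0.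
Proof. by rewrite [RHS](egf1 1) rmorph1 fpsC1. Qed.

Lemma egf_natM k P : k%:R * egf P = egf (fun n => k%:R * P n).
Proof. by rewrite -egfZ fpsC_tofrac_nat. Qed.

(** * The four generating functions *)

Lemma gfAE : gfA = z * egf (cycP false).
Proof.
have -> : gfA = z * 1 + egf_from 2 (fun n => affine_A n.-1) by rewrite mulr1.
rewrite egf_one !egfX (egf_fromE 2) egfD.
apply: eq_egf; rewrite /delta0 => -[|[|n]] /=; rewrite ?addr0 ?mul0r //.
  by rewrite cycP0 mulr1.
by rewrite mulr0 add0r affine_AE sum_wtA.
Qed.

Lemma gfCE : gfC = egf (cycP true).
Proof.
rewrite /gfC egf_one (egf_fromE 1) egfD; apply: eq_egf; rewrite /delta0 => -[|n] /=.
  by rewrite cycP0 addr0.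
by rewrite add0r affine_CE.
Qed.

Lemma gfBE : gfB = 2 * egf (cycP true) - 2 * (t * (z * egf halfP)).
Proof.
have -> : gfB = 2 * egf delta0 + 2 * (t * (z * egf delta0)) + egf_from 2 affine_B.
  by rewrite -egf_one (mulr1 z) (mulr1 2) mulrA.
rewrite (egf_fromE 2) !(egfX, egfZ, egf_natM, egfD, egfB).
(* Degrees 0 and 1 check that the conventional terms 2 + 2 t z fit the general formula. *)
apply: eq_egf; rewrite /delta0 => -[|[|n]] /=.
- by rewrite cycP0; ring.
- by rewrite cycPS cycP0 halfP0 /ins_op derivC muln0 -[true.+1]/2%N; ring.
by rewrite affine_BE sum_wtB natrM -/(cycP _ _) -/(halfP _); ring.
Qed.

Lemma two_unit : (2 : fps Qt) \is a GRing.unit.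
Proof.
by rewrite fps_unitE -(fpsC_nat Qt 2) fcoefC mulr1n unitfE Qt_natr_neq0.
Qed.

Lemma gfDE : gfD = 2 * egf (cycP true) + 2 * (t * (z * (z * egf (cycP true))))
   - 4 * (t * (z * egf halfP)).
Proof.
have -> : gfD = 2 * egf delta0 + 2 * (t * (z * (z * egf delta0))) + egf_from 3 affine_D.
  rewrite -egf_one (mulr1 z) (mulr1 2); congr (_ + _ + _).
  have -> : 4 = 2 * 2 :> fps Qt by rewrite -natrM.
  have alg (R : comUnitRingType) (h x y : R) : h \is a GRing.unit ->
      h * h * x * (y ^+ 2 / h) = h * (x * (y * y)).
    move=> hu; have -> : h * h * x * (y ^+ 2 / h) = h * (x * (y * y)) * (h / h).
      by ring.
    by rewrite divrr ?mulr1.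
  exact: alg two_unit.
rewrite (egf_fromE 3) !(egfX, egfZ, egf_natM, egfD, egfB).
(* Degrees 0, 1 and 2 check the conventional terms; in degree 1 the contributions 4 X and - 4 X
   cancel. *)
apply: eq_egf; rewrite /delta0 => -[|[|[|n]]] /=.
- by rewrite cycP0; ring.
- by rewrite cycPS cycP0 halfP0 /ins_op derivC muln0 -[true.+1]/2%N; ring.
- rewrite cycPS cycP1 cycP0 halfPS halfP0 /ins_op derivC -[true.+1]/2%N.
  by rewrite derivM derivX -polyC_natr derivC polyC_natr; ring.
rewrite (cycP_open n); set E := \sum_(s <- _) _.
have two_neq0 : (2 : {poly rat}) != 0 by rewrite -polyC_natr polyC_eq0.
(* Both sides are doubled because [two_affine_D] determines only twice the polynomial. *)
apply: (mulfI two_neq0); have := two_affine_D n.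
rewrite sum_wtD -/(cycP _ _) -/(halfP _) -/E !natrM.
have alg (d c b e x k l : {poly rat}) :
    2 * d = 4 * c - 4 * (2 * k) * x * b + 4 * (k * l) * x ^+ 2 * e ->
  2 * (2 * 0 + 2 * (x * (k * (l * 0))) + d) =
  2 * (2 * c + 2 * (x * (k * (l * (x * e)))) - 4 * (x * (k * b))).
  by move=> h; rewrite 2!mulr0 mulr0 mulr0 mulr0 add0r add0r h; ring.
exact: alg.
Qed.

Theorem proposition6p4 :
  [/\ gfA = z * (1 - t) / (1 - t * fps_exp (z * (1 - t))),
      gfC = (1 - t) / (1 - t * fps_exp (2 * z * (1 - t))),
      gfB = 2 * (1 - t) * (1 - t * z * fps_exp (z * (1 - t)))
              / (1 - t * fps_exp (2 * z * (1 - t)))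
    & gfD = 2 * (1 - t) * (1 + t * z ^+ 2 - 2 * t * z * fps_exp (z * (1 - t)))
              / (1 - t * fps_exp (2 * z * (1 - t)))].
Proof.
have eC : egf (cycP true) = (1 - t) / (1 - t * fps_exp (2 * z * (1 - t))).
  by rewrite exp_arg_signed; exact: egf_cycP.
have eA : egf (cycP false) = (1 - t) / (1 - t * fps_exp (z * (1 - t))).
  by rewrite exp_arg_unsigned -[in RHS](mul1r (1 - 'X)); exact: egf_cycP.
rewrite gfAE gfCE gfBE gfDE egf_halfP eA eC.
have algB (R : comNzRingType) (x y e' d' : R) :
    2 * ((1 - x) * d') - 2 * (x * (y * ((1 - x) * e' * d'))) =
    2 * (1 - x) * (1 - x * y * e') * d' by ring.
have algD (R : comNzRingType) (x y e' d' : R) :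
    2 * ((1 - x) * d') + 2 * (x * (y * (y * ((1 - x) * d'))))
      - 4 * (x * (y * ((1 - x) * e' * d'))) =
    2 * (1 - x) * (1 + x * y ^+ 2 - 2 * x * y * e') * d' by ring.
split.
exact: (mulrA z (1 - t)).
reflexivity.
exact: (algB _ t z).
exact: (algD _ t z).
Qed.
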